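(* Let $H(m)$ denote the Heisenberg Lie algebra of dimension $2m+1$. Then (i) $\mathcal{M}^{(2)}(H(1))\cong A(5)$; (ii) $\mathcal{M}^{(2)}(H(m))\cong A\!\left(\frac{8m^3-2m}{3}\right)$ for all $m\geq 2$.
   Context: All Lie algebras are over a fixed field. For a Lie algebra $L$ with free presentation $L\cong F/R$ ($F$ a free Lie algebra, $R$ an ideal of $F$), the $2$-nilpotent multiplier is $\mathcal{M}^{(2)}(L)=(R\cap F^{3})/[[R,F],F]$, where $F^3=[[F,F],F]$ is the third term of the lower central series; it is independent of the chosen presentation up to isomorphism. $A(k)$ denotes the abelian Lie algebra of dimension $k$. The Heisenberg Lie algebra $H(m)$ is the Lie algebra of dimension $2m+1$ with $H(m)^2=Z(H(m))$ and $\dim H(m)^2=1$. *)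

(* Defs.v *)
From HB Require Import structures.
From mathcomp Require Import all_boot all_order all_algebra.
Set Implicit Arguments. Unset Strict Implicit. Unset Printing Implicit Defensive.
Import GRing.Theory.
Local Open Scope ring_scope.

Section Lie.
Variable K : fieldType.

Definition is_lie (V : lmodType K) (br : V -> V -> V) : Prop :=
  [/\ forall x, linear (br x),
      forall y, linear (fun x => br x y),
      forall x, br x x = 0
    & forall x y z, br x (br y z) + br y (br z x) + br z (br x y) = 0].

Definition is_lie_hom (V W : lmodType K) (brV : V -> V -> V) (brW : W -> W -> W)
  (g : V -> W) : Prop :=
  linear g /\ forall x y, g (brV x y) = brW (g x) (g y).

Definition span_of (V : lmodType K) (P : V -> Prop) (x : V) : Prop :=
  exists n (c : 'I_n -> K) (u : 'I_n -> V),
    (forall i, P (u i)) /\ x = \sum_(i < n) c i *: u i.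

Definition comm_sp (V : lmodType K) (br : V -> V -> V) (P Q : V -> Prop) : V -> Prop :=
  span_of (fun z => exists p q, [/\ P p, Q q & z = br p q]).

Definition whole (V : lmodType K) : V -> Prop := fun _ => True.

Definition is_free_lie (F : lmodType K) (br : F -> F -> F) (X : Type) (iota : X -> F) : Prop :=
  is_lie br /\
  forall (W : lmodType K) (brW : W -> W -> W), is_lie brW ->
  forall f : X -> W,
    (exists g : F -> W, is_lie_hom br brW g /\ forall x, g (iota x) = f x) /\
    (forall g1 g2 : F -> W, is_lie_hom br brW g1 -> is_lie_hom br brW g2 ->
       (forall x, g1 (iota x) = f x) -> (forall x, g2 (iota x) = f x) ->
       forall v, g1 v = g2 v).

(* The quotient space A/B (B a subspace contained in the subspace A) has
   dimension k: there are k elements of A whose classes mod B are a basis. *)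
Definition quot_dim (V : lmodType K) (A B : V -> Prop) (k : nat) : Prop :=
  exists v : 'I_k -> V,
    [/\ forall i, A (v i),
        forall c : 'I_k -> K, B (\sum_(i < k) c i *: v i) -> forall i, c i = 0
      & forall x, A x -> exists c : 'I_k -> K, B (x - \sum_(i < k) c i *: v i)].

Definition derived (V : lmodType K) (br : V -> V -> V) : V -> Prop :=
  comm_sp br (@whole V) (@whole V).
Definition centre (V : lmodType K) (br : V -> V -> V) : V -> Prop :=
  fun z => forall x, br z x = 0.

Definition is_heisenberg (m : nat) (L : vectType K) (br : L -> L -> L) : Prop :=
  [/\ is_lie br,
      \dim (fullv : {vspace L}) = (2 * m).+1,
      forall x, derived br x <-> centre br x
    & exists z : L, z != 0 /\ forall x, derived br x <-> exists c : K, x = c *: z].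

(* For a free presentation pi : F ->> L with R = ker pi, the 2-nilpotent
   multiplier (R ∩ F^3)/[[R,F],F] is isomorphic to the abelian Lie algebra
   A(k): it is abelian (bracket inherited from F/[[R,F],F] vanishes) and has
   dimension k. *)
Definition nilmult2_is_A (F : lmodType K) (br : F -> F -> F) (R : F -> Prop) (k : nat) : Prop :=
  let F3 := comm_sp br (comm_sp br (@whole F) (@whole F)) (@whole F) in
  let RF3 := fun x => R x /\ F3 x in
  let S := comm_sp br (comm_sp br R (@whole F)) (@whole F) in
  (forall x y, RF3 x -> RF3 y -> S (br x y)) /\ quot_dim RF3 S k.

End Lie.

(* Main.v *)
(* Let R be the kernel of F ->> H(m) and S = [[R,F],F].  As H(m) has class 2,
   F^3 lies in R, so the multiplier is F^3/S.  Choose e_i in F lifting a basis of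
   H(m) modulo its centre and c lifting a central vector; then F = <e_i> + <c> + R,
   and modulo S the space F^3 is spanned by triple brackets of the e_i and c.

   For m >= 2, [c,F] lies in [R,F], so the Hall commutators [[e_i,e_j],e_k] with
   j < i and j <= k span.  They are independent modulo S because F maps to the
   tensor algebra of H(m)/Z truncated above degree 3, under commutators: R goes
   to degree >= 2, hence S to 0, while the images of the Hall commutators are
   independent in every characteristic.

   For m = 1 take c = [e0,e1]; [c,e0], [c,e1], [[c,e0],e0], [[c,e0],e1] and
   [[c,e1],e1] span, and are independent because F maps to the free nilpotent
   Lie algebra of class 4 on two generators, with R going to its third lower
   central term and hence S to 0. *)
Require Import Defs.
From HB Require Import structures.
From mathcomp Require Import all_boot all_order all_algebra.
From mathcomp Require Import ring zify.
Import GRing.Theory.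
Local Open Scope ring_scope.

Set Implicit Arguments.
Unset Strict Implicit.
Unset Printing Implicit Defensive.

(** * Subspaces as predicates, spans, and bases of quotients *)

Section Subspaces.
Variable K : fieldType.
Implicit Types V W : lmodType K.

Definition subspace V (P : V -> Prop) : Prop :=
  P 0 /\ forall a x y, P x -> P y -> P (a *: x + y).

Section Closure.
Variables (V : lmodType K) (P : V -> Prop).
Hypothesis subP : subspace P.

Lemma subspace0 : P 0. Proof. by case: subP. Qed.

Lemma subspaceZ a x : P x -> P (a *: x).
Proof. by case: subP => P0 PD Px; rewrite -[_ *: _]addr0; apply: PD. Qed.

Lemma subspaceD x y : P x -> P y -> P (x + y).
Proof. by case: subP => P0 PD Px Py; rewrite -[x]scale1r; apply: PD. Qed.

Lemma subspaceN x : P x -> P (- x).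
Proof. by rewrite -scaleN1r; apply: subspaceZ. Qed.

Lemma subspaceB x y : P x -> P y -> P (x - y).
Proof. by move=> Px Py; apply: subspaceD => //; apply: subspaceN. Qed.

Lemma subspace_sum (I : finType) (u : I -> V) :
  (forall i, P (u i)) -> P (\sum_i u i).
Proof.
move=> Pu; apply: (big_ind P) => //; first exact: subspace0.
exact: subspaceD.
Qed.

End Closure.

Lemma subspace_span V (P : V -> Prop) : subspace (span_of P).
Proof.
split.
  by exists 0%N, (fun=> 0), (fun=> 0); split; [case | rewrite big_ord0].
move=> a _ _ [n1 [c1 [u1 [P1 ->]]]] [n2 [c2 [u2 [P2 ->]]]].
exists (n1 + n2)%N.
exists (fun i => match split i with inl j => a * c1 j | inr j => c2 j end).
exists (fun i => match split i with inl j => u1 j | inr j => u2 j end).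
split; first by move=> i; case: (split i).
rewrite big_split_ord /= scaler_sumr; congr (_ + _); apply: eq_bigr => i _.
  by rewrite (unsplitK (inl i)) scalerA.
by rewrite (unsplitK (inr i)).
Qed.

Lemma span_of_gen V (P : V -> Prop) x : P x -> span_of P x.
Proof.
move=> Px; exists 1%N, (fun=> 1), (fun=> x); split=> //.
by rewrite big_ord1 scale1r.
Qed.

Lemma span_of_min V (P Q : V -> Prop) :
  subspace Q -> (forall x, P x -> Q x) -> forall x, span_of P x -> Q x.
Proof.
move=> subQ PQ _ [n [c [u [Pu ->]]]]; apply: subspace_sum => // i.
by apply: subspaceZ => //; apply: PQ.
Qed.

Section LinearProp.
Variables (V W : lmodType K) (f : V -> W).
Hypothesis lf : linear f.

Lemma lin0 : f 0 = 0.
Proof. by have := lf (-1) 0 0; rewrite scaler0 addr0 scaleN1r addNr. Qed.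

Lemma linD x y : f (x + y) = f x + f y.
Proof. by have := lf 1 x y; rewrite !scale1r. Qed.

Lemma linZ a x : f (a *: x) = a *: f x.
Proof. by have := lf a x 0; rewrite lin0 !addr0. Qed.

Lemma linN x : f (- x) = - f x.
Proof. by rewrite -scaleN1r linZ scaleN1r. Qed.

Lemma linB x y : f (x - y) = f x - f y.
Proof. by rewrite linD linN. Qed.

Lemma lin_sum (I : finType) (u : I -> V) : f (\sum_i u i) = \sum_i f (u i).
Proof. by apply: (big_morph f linD lin0). Qed.

Lemma subspace_preim (P : W -> Prop) : subspace P -> subspace (fun x => P (f x)).
Proof.
move=> [P0 PD]; split=> [|a x y Px Py]; first by rewrite lin0.
by rewrite lf; apply: PD.
Qed.

End LinearProp.

Lemma subspace_ker V W (f : V -> W) : linear f -> subspace (fun x => f x = 0).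
Proof.
by move=> lf; apply: (subspace_preim lf (P := fun y => y = 0));
  split=> // a x y -> ->; rewrite scaler0 addr0.
Qed.

Lemma linear_comp V W (U : lmodType K) (f : V -> W) (g : W -> U) :
  linear f -> linear g -> linear (fun x => g (f x)).
Proof. by move=> lf lg a x y; rewrite lf lg. Qed.

(** The spanning clause of [quot_dim] over any finite index type. Being a subspace, it can be
    checked on generators. *)
Definition span_mod V (I : finType) (v : I -> V) (B : V -> Prop) (x : V) : Prop :=
  exists c : I -> K, B (x - \sum_i c i *: v i).

Section SpanMod.
Variables (V : lmodType K) (I : finType) (v : I -> V) (B : V -> Prop).
Hypothesis subB : subspace B.

Lemma sub_span_mod x : B x -> span_mod v B x.
Proof.
move=> Bx; exists (fun=> 0); rewrite big1 ?subr0 // => i _; exact: scale0r.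
Qed.

Lemma gen_span_mod i : span_mod v B (v i).
Proof.
exists (fun j => (j == i)%:R); rewrite (bigD1 i) //= eqxx scale1r big1 ?addr0.
  by rewrite subrr; apply: subspace0.
by move=> j /negbTE ->; rewrite scale0r.
Qed.

Lemma subspace_span_mod : subspace (span_mod v B).
Proof.
split; first by apply: sub_span_mod; apply: subspace0.
move=> a x y [c Bx] [d By]; exists (fun i => a * c i + d i).
have -> : a *: x + y - \sum_i (a * c i + d i) *: v i =
  a *: (x - \sum_i c i *: v i) + (y - \sum_i d i *: v i).
  rewrite scalerBr scaler_sumr addrACA -opprD -big_split /=.
  by congr (_ - _); apply: eq_bigr => i _; rewrite scalerDl scalerA.
by case: subB => _; apply.
Qed.

End SpanMod.

(** Enumerating [I] reduces this to ordinals; a basis can then be indexed directly by Hall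
    triples. *)
Lemma quot_dim_fin V (A B : V -> Prop) (I : finType) (v : I -> V) :
  (forall i, A (v i)) ->
  (forall c : I -> K, B (\sum_i c i *: v i) -> forall i, c i = 0) ->
  (forall x, A x -> span_mod v B x) ->
  quot_dim A B #|I|.
Proof.
move=> Av indep sp; exists (fun i => v (enum_val i)); split=> //.
  move=> c Bc i; rewrite -[i]enum_valK.
  apply: (indep (fun j => c (enum_rank j))).
  rewrite (reindex_onto (enum_val : 'I_#|I| -> I) enum_rank) /=; last first.
    by move=> j _; rewrite enum_rankK.
  move: Bc; congr B; apply: eq_big => [j | j _]; first by rewrite enum_valK eqxx.
  by rewrite enum_valK.
move=> x /sp [c Bc]; exists (fun i => c (enum_val i)).
move: Bc; congr B; congr (_ - _).
rewrite (reindex_onto (enum_val : 'I_#|I| -> I) enum_rank) /=; last first.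
  by move=> j _; rewrite enum_rankK.
by apply: eq_bigl => j; rewrite enum_valK eqxx.
Qed.

(** Applying [phi i] to a combination lying in [B] isolates [c i] up to a nonzero factor. The factor
    need not be 1: for Hall commutators it can be -1. *)
Lemma indep_of_dual V (B : V -> Prop) (I : finType) (v : I -> V)
    (phi : I -> V -> K^o) :
  (forall i, linear (phi i)) ->
  (forall i x, B x -> phi i x = 0) ->
  (forall i, phi i (v i) != 0) ->
  (forall i j, i != j -> phi i (v j) = 0) ->
  forall c : I -> K, B (\sum_i c i *: v i) -> forall i, c i = 0.
Proof.
move=> lphi phiB phi_diag phi_off c Bc i; have := phiB i _ Bc.
rewrite (lin_sum (lphi i)) (bigD1 i) //= big1 => [|j ji].
  rewrite addr0 (linZ (lphi i)) => /eqP.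
  by rewrite mulf_eq0 (negbTE (phi_diag i)) orbF => /eqP.
by rewrite (linZ (lphi i)) phi_off ?scaler0 // eq_sym.
Qed.

End Subspaces.

(** * Bracket calculus and the third lower central term *)

Section LieBasics.
Variables (K : fieldType) (V : lmodType K) (br : V -> V -> V).
Hypothesis lie_br : is_lie br.

Lemma br_linr x : linear (br x). Proof. by case: lie_br. Qed.
Lemma br_linl y : linear (fun x => br x y). Proof. by case: lie_br. Qed.
Lemma brxx x : br x x = 0. Proof. by case: lie_br. Qed.

Lemma brDl x y z : br (x + y) z = br x z + br y z.
Proof. exact: (linD (br_linl z)). Qed.
Lemma brDr x y z : br x (y + z) = br x y + br x z.
Proof. exact: (linD (br_linr x)). Qed.
Lemma brBl x y z : br (x - y) z = br x z - br y z.
Proof. exact: (linB (br_linl z)). Qed.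
Lemma brBr x y z : br x (y - z) = br x y - br x z.
Proof. exact: (linB (br_linr x)). Qed.
Lemma brZl a x z : br (a *: x) z = a *: br x z.
Proof. exact: (linZ (br_linl z)). Qed.
Lemma brZr a x z : br x (a *: z) = a *: br x z.
Proof. exact: (linZ (br_linr x)). Qed.
Lemma brNl x z : br (- x) z = - br x z.
Proof. exact: (linN (br_linl z)). Qed.
Lemma brNr x z : br x (- z) = - br x z.
Proof. exact: (linN (br_linr x)). Qed.
Lemma br0l z : br 0 z = 0.
Proof. exact: (lin0 (br_linl z)). Qed.

Lemma brC x y : br x y = - br y x.
Proof.
apply/eqP; rewrite -addr_eq0; apply/eqP.
by have := brxx (x + y); rewrite brDl !brDr !brxx add0r addr0.
Qed.

Lemma br_br_r x y z : br x (br y z) = br (br x y) z - br (br x z) y.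
Proof.
have [_ _ _ J] := lie_br; have := J x y z.
rewrite (brC z (br x y)) (brC z x) brNr (brC y (br x z)) opprK.
by move=> /eqP; rewrite -addrA addr_eq0 opprD opprK addrC => /eqP.
Qed.

Lemma br_br_l x y z : br (br x y) z = br (br x z) y + br x (br y z).
Proof. by rewrite br_br_r addrC subrK. Qed.

Lemma lower_central3_min (Q : V -> Prop) :
  subspace Q -> (forall a b d, Q (br (br a b) d)) ->
  forall x, comm_sp br (comm_sp br (@whole K V) (@whole K V)) (@whole K V) x -> Q x.
Proof.
move=> subQ Qbr; apply: span_of_min => // _ [p [d [Fp _ ->]]].
move: p Fp; apply: span_of_min; first exact: (subspace_preim (br_linl d)).
by move=> _ [a [b [_ _ ->]]].
Qed.

Lemma lower_central3_br a b d :
  comm_sp br (comm_sp br (@whole K V) (@whole K V)) (@whole K V) (br (br a b) d).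
Proof.
apply: span_of_gen; exists (br a b), d; split=> //.
by apply: span_of_gen; exists a, b.
Qed.

End LieBasics.

(** * The subspaces [R,F] and [[R,F],F] *)

Section RelativeLowerCentral.
Variables (K : fieldType) (V : lmodType K) (br : V -> V -> V) (R : V -> Prop).
Hypothesis lie_br : is_lie br.

Let C := comm_sp br R (@whole K V).
Let S := comm_sp br C (@whole K V).

Lemma RF_l r a : R r -> C (br r a).
Proof. by move=> Rr; apply: span_of_gen; exists r, a. Qed.

Lemma RF_r r a : R r -> C (br a r).
Proof.
move=> Rr; rewrite brC //; apply: subspaceN; first exact: subspace_span.
exact: RF_l.
Qed.

Lemma RFF_l x a : C x -> S (br x a).
Proof. by move=> Cx; apply: span_of_gen; exists x, a. Qed.

(** Jacobi gives [x,[a,b]] = [[x,a],b] - [[x,b],a]. The vector x may lie outside R, as does the lift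
    of a central vector when m >= 2; only its brackets with a and b matter. *)
Lemma RFF_br x a b : C (br x a) -> C (br x b) -> S (br x (br a b)).
Proof.
move=> Ca Cb; rewrite br_br_r //; apply: subspaceB; first exact: subspace_span.
  exact: RFF_l.
exact: RFF_l.
Qed.

Lemma RFF_br' x a b : C (br x a) -> C (br x b) -> S (br (br a b) x).
Proof.
move=> Ca Cb; rewrite brC //; apply: subspaceN; first exact: subspace_span.
exact: RFF_br.
Qed.

(** This makes the multiplier abelian. *)
Lemma RFF_ideal x y : R x ->
  comm_sp br (comm_sp br (@whole K V) (@whole K V)) (@whole K V) y -> S (br x y).
Proof.
move=> Rx; move: y; apply: (lower_central3_min lie_br).
  by apply: subspace_preim; [exact: br_linr | exact: subspace_span].
by move=> a b d; apply: RFF_br; apply: RF_l.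
Qed.

Lemma RFF_min (Q : V -> Prop) : subspace Q ->
  (forall r a b, R r -> Q (br (br r a) b)) -> forall x, S x -> Q x.
Proof.
move=> subQ Qbr; apply: span_of_min => // _ [p [d [Fp _ ->]]].
move: p Fp; apply: span_of_min; first exact: (subspace_preim (br_linl lie_br d)).
by move=> _ [a [b [Ra _ ->]]]; apply: Qbr.
Qed.

Section Generators.
Variables (I : finType) (e : I -> V) (c : V).
Hypothesis gen : forall a, exists (k : I -> K) (l : K),
  R (a - (\sum_i k i *: e i + l *: c)).

Lemma generators_ind (Q : V -> Prop) (f : V -> V) : subspace Q -> linear f ->
  (forall i, Q (f (e i))) -> Q (f c) -> (forall r, R r -> Q (f r)) ->
  forall a, Q (f a).
Proof.
move=> subQ lf Qe Qc Qr a; have [k [l Ra]] := gen a.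
rewrite -[a](subrK (\sum_i k i *: e i + l *: c)) linD //.
apply: subspaceD; [by [] | exact: Qr |]; rewrite linD // linZ // lin_sum //.
apply: subspaceD; [by [] | | by apply: subspaceZ].
by apply: subspace_sum => // i; rewrite linZ //; apply: subspaceZ.
Qed.

(* A triple bracket with an entry in R lies in [[R,F],F], whichever entry it
   is, so only the generators matter modulo [[R,F],F]. *)
Lemma triple_brackets_ind (Q : V -> Prop) : subspace Q -> (forall x, S x -> Q x) ->
  let G x := (exists i, x = e i) \/ x = c in
  (forall a b d, G a -> G b -> G d -> Q (br (br a b) d)) ->
  forall a b d, Q (br (br a b) d).
Proof.
move=> subQ SQ G Qgen.
have Ge i : G (e i) by left; exists i.
have Gc : G c by right.
have Q2 a b d : G a -> G b -> Q (br (br a b) d).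
  move=> Ga Gb; move: d; apply: (generators_ind (f := br (br a b))) => //; first exact: br_linr.
  - by move=> i; apply: Qgen.
  - exact: Qgen.
  - by move=> r Rr; apply: SQ; apply: RFF_br'; apply: RF_l.
have Q1 a b d : G a -> Q (br (br a b) d).
  move=> Ga; move: b; apply: (generators_ind (Q := Q) (f := fun b => br (br a b) d)) => //.
  - by apply: (linear_comp (f := br a) (g := br^~ d)); [exact: br_linr | exact: (br_linl lie_br)].
  - by move=> i; apply: Q2.
  - exact: Q2.
  - by move=> r Rr; apply: SQ; apply: RFF_l; apply: RF_r.
move=> a b d; move: a; apply: (generators_ind (Q := Q) (f := fun a => br (br a b) d)) => //.
- by apply: (linear_comp (f := br^~ b) (g := br^~ d));
    exact: (br_linl lie_br).
- by move=> i; apply: Q1.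
- exact: Q1.
- by move=> r Rr; apply: SQ; apply: RFF_l; apply: RF_l.
Qed.

End Generators.
End RelativeLowerCentral.

(** * Adapted bases and hyperbolic pairs in Heisenberg algebras *)

Lemma coordinates_with_vector (K : fieldType) (L : vectType K) (z : L) (n : nat) :
  z != 0 -> \dim (fullv : {vspace L}) = n.+1 ->
  exists (e : 'I_n -> L) (h : 'I_n -> L -> K^o) (h0 : L -> K^o),
    [/\ (forall i, linear (h i)) /\ linear h0,
        forall v, v = \sum_i h i v *: e i + h0 v *: z,
        forall i j, h i (e j) = (i == j)%:R
      & [/\ forall i, h i z = 0, forall i, h0 (e i) = 0 & h0 z = 1]].
Proof.
move=> z0 dimL; pose U := (<[z]>^C)%VS.
have dimU : \dim U = n by rewrite dimv_compl dimL dim_vline z0 subn1.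
pose b := vbasis U.
have szb : size (z :: b) = n.+1 by rewrite /= size_tuple dimU.
pose X : n.+1.-tuple L := Tuple (introT eqP szb).
have bX : basis_of fullv X.
  rewrite basisEdim dimL szb leqnn andbT /= span_cons (span_basis (vbasisP U)).
  by rewrite addv_complf subvv.
have fX := basis_free bX.
have coordX v := coord_basis bX (memvf v).
exists (fun i => X`_(lift ord0 i)), (fun i => coord X (lift ord0 i)), (coord X ord0).
split.
- by split=> [i|] a x y; rewrite linearP.
- by move=> v; rewrite {1}(coordX v) big_ord_recl addrC.
- by move=> i j; rewrite coord_free // (inj_eq lift_inj) eq_sym.
- by split=> [i|i|]; rewrite -?[z]/(X`_(@ord0 n)) coord_free.
Qed.

Section HeisenbergPairs.
Variables (K : fieldType) (L : vectType K) (br : L -> L -> L) (z : L).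
Hypothesis lie_br : is_lie br.
Hypothesis br_z : forall x y, exists c : K, br x y = c *: z.
Hypothesis centre_z : forall x, centre br x -> exists c : K, x = c *: z.

(** A vector commuting with a whole basis is central, hence a multiple of z. Otherwise some basis
    vector pairs with u to a nonzero multiple of z and can be rescaled. *)
Lemma heisenberg_partner u : (forall c : K, u <> c *: z) -> exists w, br u w = z.
Proof.
move=> uz; pose b := vbasis (fullv : {vspace L}).
case: (pickP (fun i : 'I_(\dim (fullv : {vspace L})) => br u b`_i != 0)) => [i | ub].
  have [c E] := br_z u b`_i; rewrite E scaler_eq0 negb_or => /andP[c0 _].
  by exists (c^-1 *: b`_i); rewrite brZr // E scalerA mulVf // scale1r.
case: (centre_z (x := u)) => [x | c uc]; last by case: (uz c).
rewrite (coord_basis (vbasisP fullv) (memvf x)) (lin_sum (br_linr lie_br u)).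
by rewrite big1 // => i _; rewrite brZr //; move/eqP: (ub i) => ->; rewrite scaler0.
Qed.

(* Two steps of symplectic Gram-Schmidt: complete u to a hyperbolic pair (u, w0)
   and find a second hyperbolic pair orthogonal to it. *)
Lemma heisenberg_orthogonal_pair u :
  (3 < \dim (fullv : {vspace L}))%N -> (forall c : K, u <> c *: z) ->
  exists v w, [/\ br v w = z, br u v = 0 & br u w = 0].
Proof.
move=> dimL uz; have [w0 uw0] := heisenberg_partner uz.
have [v0 v0P] : exists v0, v0 \notin <<[:: u; w0; z]>>%VS.
  have /subvPn [v _ vP] : ~~ ((fullv : {vspace L}) <= <<[:: u; w0; z]>>)%VS.
    apply/negP => /dimvS; have := dim_span [:: u; w0; z] => /= d3 d4.
    by have := leq_trans (leq_trans dimL d4) d3.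
  by exists v.
have [s v0u] := br_z v0 u; have [t v0w] := br_z v0 w0.
(* Since [u,w0] = z, this is the projection of v0 to the orthogonal complement of u and w0. *)
pose v := v0 + s *: w0 - t *: u.
have vu : br v u = 0.
  rewrite /v brBl // brDl // !brZl // brxx // v0u (brC lie_br w0) uw0.
  by rewrite scaler0 subr0 scalerN subrr.
have vw : br v w0 = 0.
  by rewrite /v brBl // brDl // !brZl // brxx // v0w uw0 scaler0 addr0 subrr.
have vz (c : K) : v <> c *: z.
  move=> E; case/negP: v0P; have -> : v0 = c *: z - s *: w0 + t *: u.
    by rewrite -E /v addrAC subrK addrK.
  by rewrite rpredD ?rpredB ?rpredZ ?memv_span // !inE eqxx ?orbT.
have [w1 vw1] := heisenberg_partner vz; have [p uw1] := br_z u w1.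
(* Subtracting p w0 makes w1 orthogonal to u and keeps [v,w1] = z, because [v,w0] = 0. *)
exists v, (w1 - p *: w0); split.
- by rewrite brBr // brZr // vw scaler0 subr0.
- by rewrite brC // vu oppr0.
- by rewrite brBr // brZr // uw0 uw1 subrr.
Qed.

End HeisenbergPairs.

(** * The tensor algebra truncated above degree 3 *)

Section TruncatedTensorAlgebra.
Variables (K : fieldType) (n : nat).

(* Degrees 1, 2 and 3 of the tensor algebra of K^n. *)
Definition tensor3 : lmodType K := ('rV[K]_n * 'M[K]_n * {ffun 'I_n -> 'M[K]_n})%type.

(** The commutator xy - yx, with terms above degree 3 dropped. Entry [i j k] of the last component
    is the coefficient of the word e_i e_j e_k. *)
Definition tensor3_br (x y : tensor3) : tensor3 :=
  (0, \matrix_(i, j) (x.1.1 0 i * y.1.1 0 j - y.1.1 0 i * x.1.1 0 j),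
   [ffun i => \matrix_(j, k) (x.1.1 0 i * y.1.2 j k + x.1.2 i j * y.1.1 0 k -
                              (y.1.1 0 i * x.1.2 j k + y.1.2 i j * x.1.1 0 k))]).

Lemma tensor3_eq (x y : tensor3) :
  (forall i, x.1.1 0 i = y.1.1 0 i) -> (forall i j, x.1.2 i j = y.1.2 i j) ->
  (forall i j k, x.2 i j k = y.2 i j k) -> x = y.
Proof.
case: x y => [[x1 x2] x3] [[y1 y2] y3] /= E1 E2 E3; congr (_, _, _).
- by apply/rowP.
- by apply/matrixP.
- by apply/ffunP => i; apply/matrixP => j k.
Qed.

Lemma tensor3_lie : is_lie tensor3_br.
Proof.
split.
- move=> x a y y'; apply: tensor3_eq => *; rewrite /= !(mxE, ffunE) /=; ring.
- move=> y a x x'; apply: tensor3_eq => *; rewrite /= !(mxE, ffunE) /=; ring.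
- move=> x; apply: tensor3_eq => *; rewrite /= !(mxE, ffunE) /=; ring.
- move=> x y z; apply: tensor3_eq => *; rewrite /= !(mxE, ffunE) /=; ring.
Qed.

(** Only the degree 1 parts enter, so a triple bracket whose first entry has none vanishes in degree
    3. *)
Lemma tensor3_br_br (x y z : tensor3) i j k :
  (tensor3_br (tensor3_br x y) z).2 i j k =
  (x.1.1 0 i * y.1.1 0 j - y.1.1 0 i * x.1.1 0 j) * z.1.1 0 k -
  z.1.1 0 i * (x.1.1 0 j * y.1.1 0 k - y.1.1 0 j * x.1.1 0 k).
Proof. rewrite /= !(mxE, ffunE) /=; ring. Qed.

End TruncatedTensorAlgebra.

(** * Counting Hall commutators of weight 3 *)

Section HallTriples.
Variable n : nat.
Local Open Scope nat_scope.

Lemma card_ord_geq j : #|[set k : 'I_n | j <= k]| = n - j.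
Proof.
rewrite cardsE -sum1_card -[RHS]muln1 -sum_nat_const_nat.
by rewrite (big_geq_mkord _ _ xpredT (fun=> 1)).
Qed.

(* (j, (i, k)) stands for the Hall commutator [[e_i, e_j], e_k]. *)
Definition hall_triple (t : 'I_n * ('I_n * 'I_n)) : bool :=
  (t.1 < t.2.1) && (t.1 <= t.2.2).

(** A fixed j leaves n - j - 1 choices of i and n - j of k. Reversing the order of j turns the total
    into the sum of j(j+1) over j < n, which is (n^3 - n)/3 by induction. *)
Lemma card_hall_triple : #|{: {t | hall_triple t}}| = (n ^ 3 - n) %/ 3.
Proof.
rewrite card_sig -sum1_card.
rewrite -(pair_big_dep xpredT (fun j p => hall_triple (j, p)) (fun _ _ => 1)) /=.
have E (j : 'I_n) : \sum_(p | hall_triple (j, p)) 1 = (n - j.+1) * (n - j).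
  rewrite sum1_card.
  rewrite (_ : #|_| = #|setX [set i : 'I_n | j < i] [set k : 'I_n | j <= k]|); last first.
    by apply: eq_card => p; rewrite !inE.
  rewrite cardsX; congr (_ * _).
    exact: card_ord_geq.
  exact: card_ord_geq.
rewrite (eq_bigr _ (fun j _ => E j)) (reindex_inj rev_ord_inj) /=.
rewrite (eq_bigr (fun j : 'I_n => j * j.+1)) => [|j _]; last first.
  by have := ltn_ord j; move: (val j) => ? ?; congr (_ * _); lia.
suff -> : n ^ 3 - n = 3 * \sum_(j < n) j * j.+1 by rewrite mulKn.
elim: (n) => [|p IH]; first by rewrite big_ord0.
by rewrite big_ord_recr /= mulnDr -IH; nia.
Qed.

End HallTriples.

(** * The free nilpotent Lie algebra of class 4 on two generators *)

Section FreeNilpotent4.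
Variable K : fieldType.

(* The free nilpotent Lie algebra of class 4 on two generators, with the basis
   e0, e1, c = [e0,e1], p = [c,e0], q = [c,e1], [p,e0], [p,e1] = [q,e0], [q,e1]. *)
Definition nil4_br (x y : 'rV[K]_8) : 'rV[K]_8 :=
  let X i := x 0 (inord i) in let Y i := y 0 (inord i) in
  let D i j := X i * Y j - X j * Y i in
  \row_i [:: 0; 0; D 0 1; D 2 0; D 2 1; D 3 0; D 3 1 + D 4 0; D 4 1]`_i.

Lemma nil4_brE (x y : 'rV[K]_8) i : (i < 8)%N ->
  let X i := x 0 (inord i) in let Y i := y 0 (inord i) in
  let D i j := X i * Y j - X j * Y i in
  nil4_br x y 0 (inord i) =
    [:: 0; 0; D 0 1; D 2 0; D 2 1; D 3 0; D 3 1 + D 4 0; D 4 1]`_i.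
Proof. by move=> i8; rewrite mxE inordK. Qed.

Lemma nil4_eq (x y : 'rV[K]_8) :
  (forall i, (i < 8)%N -> x 0 (inord i) = y 0 (inord i)) -> x = y.
Proof. by move=> E; apply/rowP => i; rewrite -[i]inord_val E. Qed.

Lemma nil4_lie : is_lie nil4_br.
Proof.
split.
- move=> x a y y'; apply: nil4_eq; do 8?[case=> [_|]] => //; rewrite !(mxE, inordK) //=; ring.
- move=> y a x x'; apply: nil4_eq; do 8?[case=> [_|]] => //; rewrite !(mxE, inordK) //=; ring.
- move=> x; apply: nil4_eq; do 8?[case=> [_|]] => //; rewrite !(mxE, inordK) //=; ring.
- move=> x y z; apply: nil4_eq => i i8; rewrite [LHS]mxE [X in X + _]mxE [RHS]mxE.
  rewrite !nil4_brE //=.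
  (* ring would compare the indices of these entries by conversion *)
  move: (x 0 (inord 0)) (x 0 (inord 1)) (x 0 (inord 2)) (x 0 (inord 3)) (x 0 (inord 4))
    (y 0 (inord 0)) (y 0 (inord 1)) (y 0 (inord 2)) (y 0 (inord 3)) (y 0 (inord 4))
    (z 0 (inord 0)) (z 0 (inord 1)) (z 0 (inord 2)) (z 0 (inord 3)) (z 0 (inord 4)) => *.
  by move: i i8; do 8?[case=> [_|]] => //=; ring.
Qed.

(** Here r has weight at least 3, so two further brackets reach weight 5. *)
Lemma nil4_br_br0 (r a b : 'rV[K]_8) :
  r 0 (inord 0) = 0 -> r 0 (inord 1) = 0 -> r 0 (inord 2) = 0 ->
  nil4_br (nil4_br r a) b = 0.
Proof.
move=> r0 r1 r2; set s := nil4_br r a.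
have [s0 s1 s2 s3 s4] : [/\ s 0 (inord 0) = 0, s 0 (inord 1) = 0,
    s 0 (inord 2) = 0, s 0 (inord 3) = 0 & s 0 (inord 4) = 0].
  by rewrite !nil4_brE //= r0 r1 r2 !(mul0r, subr0).
apply: nil4_eq => i i8; rewrite nil4_brE // [RHS]mxE s0 s1 s2 s3 s4.
by move: i i8; do 8?[case=> [_|]] => //=; rewrite !(mul0r, mulr0, subr0, addr0).
Qed.

(** The entries of x and y of weight 3 and 4 are left free. Those of c in weight 3 vanish because x
    and y have no weight 2 part, and those in weight 4 die in every further bracket. *)
Lemma nil4_generators (x y : 'rV[K]_8) :
  x 0 (inord 0) = 1 -> x 0 (inord 1) = 0 -> x 0 (inord 2) = 0 ->
  y 0 (inord 0) = 0 -> y 0 (inord 1) = 1 -> y 0 (inord 2) = 0 ->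
  let c := nil4_br x y in let d i := delta_mx 0 (inord i) in
  [/\ nil4_br c x = d 3, nil4_br c y = d 4, nil4_br (d 3) x = d 5,
      nil4_br (d 3) y = d 6 & nil4_br (d 4) y = d 7].
Proof.
move=> x0 x1 x2 y0 y1 y2 c d.
have [c0 c1 c2 c3 c4] : [/\ c 0 (inord 0) = 0, c 0 (inord 1) = 0,
    c 0 (inord 2) = 1, c 0 (inord 3) = 0 & c 0 (inord 4) = 0].
  by rewrite !nil4_brE //= x0 x1 x2 y0 y1 y2 !(mul0r, mulr0, subr0, mulr1).
have dE i j : (i < 8)%N -> (j < 8)%N -> d i 0 (inord j) = (j == i)%:R.
  by move=> i8 j8; rewrite mxE eqxx /= -val_eqE /= !inordK.
by split; apply: nil4_eq => i i8; rewrite nil4_brE // ?c0 ?c1 ?c2 ?c3 ?c4 ?x0 ?x1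
    ?y0 ?y1 !dE //; move: i i8; do 8?[case=> [_|]] => //=;
    rewrite !(mulr0n, mulr1n, mul0r, mulr0, subr0, mulr1, mul1r, addr0, add0r,
    oppr0).
Qed.

End FreeNilpotent4.

(** * Dual functionals for Hall commutators and the basis criterion *)

(** [coef a b c] is the coefficient of the word abc in [[e_i,e_j],e_k]. The word j'i'k' detects its
    own Hall commutator with coefficient -1, except when k' = j': there the coefficient is -2, which
    vanishes in characteristic 2, so the word i'j'j' with coefficient 1 is used. The order
    conditions exclude all other coincidences of words. *)
Lemma hall_dual (K : fieldType) (i j k i' j' k' : nat) :
  (j < i)%N -> (j <= k)%N -> (j' < i')%N -> (j' <= k')%N ->
  let coef a b c : K :=
    ((a == i)%:R * (b == j)%:R - (a == j)%:R * (b == i)%:R) * (c == k)%:R -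
    (a == k)%:R * ((b == i)%:R * (c == j)%:R - (b == j)%:R * (c == i)%:R) in
  let phi := if k' == j' then coef i' j' j' else coef j' i' k' in
  (i = i' -> j = j' -> k = k' -> phi != 0) /\
  (~ [/\ i = i', j = j' & k = k'] -> phi = 0).
Proof.
move=> ji jk ji' jk' coef phi; split=> [Ei Ej Ek | ne].
  subst i' j' k'; rewrite /phi /coef !eqxx.
  have -> : (j == i) = false by lia.
  case: ifP => [/eqP -> | kj].
    rewrite !eqxx; have -> : (i == j) = false by lia.
    by rewrite !(mul0r, mulr0, mulr1, subr0, mul1r) oner_eq0.
  have -> : (j == k) = false by lia.
  by rewrite !(mul0r, mulr0, mulr1, subr0, mul1r, sub0r) oppr_eq0 oner_eq0.
have {}ne : i = i' -> j = j' -> k = k' -> False by move=> *; apply: ne.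
rewrite /phi /coef {phi coef}.
by case: ifP => kj; repeat (case: eqP => ?; try (exfalso; lia)); rewrite /=; ring.
Qed.

Lemma nilmult2_fin (K : fieldType) (F : lmodType K) (br : F -> F -> F)
    (R : F -> Prop) (I : finType) (v : I -> F) :
  let S := comm_sp br (comm_sp br R (@whole K F)) (@whole K F) in
  is_lie br -> (forall a b d, R (br (br a b) d)) -> subspace R ->
  (forall i, exists a b d, v i = br (br a b) d) ->
  (forall c : I -> K, S (\sum_i c i *: v i) -> forall i, c i = 0) ->
  (forall a b d, span_mod v S (br (br a b) d)) ->
  nilmult2_is_A br R #|I|.
Proof.
move=> S lie_br F3R subR vF3 indep sp; split=> [x y [Rx _] [_ Fy]|].
  exact: RFF_ideal.
apply: (quot_dim_fin (v := v)) => //.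
  by move=> i; have [a [b [d ->]]] := vF3 i; split=> //; apply: lower_central3_br.
move=> x [_ Fx]; move: x Fx; apply: lower_central3_min => //.
by apply: subspace_span_mod; apply: subspace_span.
Qed.

(** With zero bracket on the target, linear maps killing brackets are homomorphisms, so freeness
    determines them by their values on [iota]. *)
Lemma abelian_lie (K : fieldType) (V : lmodType K) : is_lie (fun _ _ : V => 0).
Proof. by split=> [? ? ? ?|? ? ? ?|//|? ? ?]; rewrite ?scaler0 !addr0. Qed.

(** * The multiplier of a Heisenberg algebra *)

Section HeisenbergMultiplier.
Variables (K : fieldType) (m : nat) (L : vectType K) (brL : L -> L -> L).
Variables (F : lmodType K) (brF : F -> F -> F) (X : Type) (iota : X -> F).
Variable pi : F -> L.
Hypothesis heis : is_heisenberg m brL.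
Hypothesis freeF : is_free_lie brF iota.
Hypothesis pi_hom : is_lie_hom brF brL pi.
Hypothesis pi_surj : forall y : L, exists x : F, pi x = y.

Let R x := pi x = 0.
Let C := comm_sp brF R (@whole K F).
Let S := comm_sp brF C (@whole K F).

Let lieL : is_lie brL. Proof. by case: heis. Qed.
Let lieF : is_lie brF. Proof. by case: freeF. Qed.
Let pi_lin : linear pi. Proof. by case: pi_hom. Qed.
Let pi_br x y : pi (brF x y) = brL (pi x) (pi y). Proof. by case: pi_hom. Qed.

Lemma heisenberg_centre_vector :
  exists z : L, [/\ z != 0, forall x y, exists c : K, brL x y = c *: z,
    forall x, centre brL x -> exists c : K, x = c *: z & forall x, brL z x = 0].
Proof.
have [_ _ dc [z [z0 dz]]] := heis; exists z; split=> //.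
- by move=> x y; apply/dz; apply: span_of_gen; exists x, y.
- by move=> x /dc/dz.
- by apply/dc; apply/dz; exists 1; rewrite scale1r.
Qed.

Lemma triple_bracket_ker a b d : R (brF (brF a b) d).
Proof.
have [z [_ br_z _ z_centre]] := heisenberg_centre_vector.
rewrite /R !pi_br; have [c ->] := br_z (pi a) (pi b).
by rewrite brZl // z_centre scaler0.
Qed.

Lemma subspaceR : subspace R. Proof. exact: subspace_ker. Qed.

Lemma generators_mod_ker n (e : 'I_n -> F) (c : F) (h : 'I_n -> L -> K) (h0 : L -> K) :
  (forall v, v = \sum_i h i v *: pi (e i) + h0 v *: pi c) ->
  forall a, exists (k : 'I_n -> K) (l : K), R (a - (\sum_i k i *: e i + l *: c)).
Proof.
move=> hE a; exists (h^~ (pi a)), (h0 (pi a)).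
rewrite /R linB // linD // linZ // lin_sum //.
under [X in _ - (X + _)]eq_bigr do rewrite linZ //.
by rewrite -hE subrr.
Qed.

(* Any f outside the centre modulo R is orthogonal to a hyperbolic pair (v, w);
   then c = [v,w] modulo R, and Jacobi moves [[v,w],f] into [R,F]. *)
Lemma centre_lift_bracket (c f : F) : (2 <= m)%N ->
  (forall x y, exists k : K, brL x y = k *: pi c) ->
  (forall x, centre brL x -> exists k : K, x = k *: pi c) ->
  pi c != 0 -> C (brF c f).
Proof.
move=> m2 br_z centre_z z0.
have subC : subspace C by apply: subspace_span.
have [/vlineP [k fk] | uz] := boolP (pi f \in <[pi c]>%VS).
  (* Modulo R, f is a multiple of c, and [c,c] = 0. *)
  have -> : brF c f = brF c (f - k *: c).
    by rewrite brBr // brZr // brxx // scaler0 subr0.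
  by apply: RF_r => //; rewrite /R linB // linZ // fk subrr.
have {}uz (k : K) : pi f <> k *: pi c.
  by move=> E; case/negP: uz; rewrite E; apply/vlineP; exists k.
have [|v [w [vw fv fw]]] := heisenberg_orthogonal_pair lieL br_z centre_z _ uz.
  by have [_ -> _ _] := heis; lia.
have [v' Ev] := pi_surj v; have [w' Ew] := pi_surj w; subst v w.
rewrite -[c](subrK (brF v' w')) brDl //; apply: subspaceD => //.
  by apply: RF_l; rewrite /R linB // pi_br vw subrr.
rewrite (br_br_l lieF); apply: subspaceD => //.
  by apply: RF_l; rewrite /R pi_br brC // fv oppr0.
by apply: RF_r => //; rewrite /R pi_br brC // fw oppr0.
Qed.

Lemma nilmult2_heisenberg_ge2 : (2 <= m)%N ->
  nilmult2_is_A brF R ((8 * m ^ 3 - 2 * m) %/ 3).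
Proof.
move=> m2; have [z [z0 br_z centre_z z_centre]] := heisenberg_centre_vector.
set n := (2 * m)%N; have dimL : \dim (fullv : {vspace L}) = n.+1 by case: heis.
have [e0 [h [h0 [[lh lh0] hE he [hz h0e h0z]]]]] := coordinates_with_vector z0 dimL.
have [e eE] := fin_all_exists (fun i => pi_surj (e0 i)).
have [c cE] := pi_surj z.
(* With n = 2m the dimension becomes the number of Hall triples. *)
have -> : (8 * m ^ 3 - 2 * m)%N = (n ^ 3 - n)%N by rewrite /n expnMn.
rewrite -card_hall_triple.
pose v (t : {t : 'I_n * ('I_n * 'I_n) | hall_triple t}) :=
  brF (brF (e (val t).2.1) (e (val t).1)) (e (val t).2.2).
have subS : subspace S by apply: subspace_span.
apply: (nilmult2_fin (v := v)) => //.
- exact: triple_bracket_ker.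
- exact: subspaceR.
- by move=> t; exists (e (val t).2.1), (e (val t).1), (e (val t).2.2).
- have [[g [[lg g_br] g_iota]] _] := freeF.2 _ _ (tensor3_lie K n)
    (fun x => (\row_i h i (pi (iota x)), 0, 0)).
  (* Both sides are homomorphisms to an abelian algebra, as each [h i] kills z, and they agree on
     [iota]. Hence g sends R to elements without degree 1 part. *)
  have g1 x : (g x).1.1 = \row_i h i (pi x).
    have [_ /(_ (fun x => (g x).1.1) (fun x => \row_i h i (pi x)))] := freeF.2 _ _
      (abelian_lie 'rV[K]_n) (fun x => \row_i h i (pi (iota x))).
    apply=> //.
    + by split=> [a y y' | y y']; rewrite ?lg ?g_br.
    + split=> [a y y' | y y'].
        by apply/rowP => i; rewrite !mxE pi_lin lh.
      apply/rowP => i; rewrite !mxE pi_br; have [k ->] := br_z (pi y) (pi y').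
      by rewrite (linZ (lh i)) hz scaler0.
    + by move=> y; rewrite g_iota.
  pose phi (t : {t : 'I_n * ('I_n * 'I_n) | hall_triple t}) (x : F) : K^o :=
    let: (j, (i, k)) := val t in
    if k == j then (g x).2 i j j else (g x).2 j i k.
  have phi_v t t' : (val t = val t' -> phi t (v t') != 0) /\
                    (val t <> val t' -> phi t (v t') = 0).
    move: (valP t) (valP t'); rewrite /phi /v.
    case: (val t) => j' [i' k']; case: (val t') => j [i k] /=.
    move=> /andP[/= ji' jk'] /andP[/= ji jk].
    have [D O] := hall_dual K ji jk ji' jk'.
    rewrite !g_br !tensor3_br_br !g1 !mxE !eE !he -!val_eqE /=.
    split=> [[] Ej Ei Ek | ne]; first by apply: D; rewrite ?Ej ?Ei ?Ek.
    by apply: O => -[Ei Ej Ek]; apply: ne; congr (_, (_, _)); apply: val_inj.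
  have lphi t : linear (phi t).
    move=> a x y; rewrite /phi lg; case: (val t) => j [i k].
    by case: ifP => _; rewrite /= !ffunE !mxE.
  apply: (indep_of_dual (phi := phi)) => //.
  + move=> t; apply: RFF_min => //; first exact: subspace_ker.
    move=> r a b Rr; rewrite /phi; case: (val t) => j [i k].
    have r0 l : (g r).1.1 0 l = 0 by rewrite g1 mxE Rr (lin0 (lh l)).
    by rewrite !g_br !tensor3_br_br !r0 !(mul0r, mulr0, subr0) if_same.
  + by move=> t; have [-> //] := phi_v t t.
  + by move=> t t' /eqP tt'; have [_ ->] // := phi_v t t'; move/val_inj.
- have Cc f : C (brF c f).
    by apply: centre_lift_bracket; rewrite ?cE.
  have Cc' f : C (brF f c).
    by rewrite brC //; apply: subspaceN => //; apply: subspace_span.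
  have subQ := subspace_span_mod v subS.
  have SQ x : S x -> span_mod v S x by apply: sub_span_mod.
  apply: (@triple_brackets_ind _ _ _ R lieF _ e c _ (span_mod v S)) => //.
    by apply: (generators_mod_ker (h := h) (h0 := h0)) => u;
      rewrite {1}[u]hE cE; congr (_ + _); apply: eq_bigr => i _; rewrite eE.
  move=> a b d [[i ->] | ->]; last by move=> _ _; apply/SQ/RFF_l/Cc.
  move=> [[j ->] | ->]; last by move=> _; apply/SQ/RFF_l/Cc'.
  move=> [[k ->] | ->]; last by apply: SQ; apply: RFF_br' => //; apply: Cc.
  have Qhall (i' j' k' : 'I_n) : (j' < i')%N -> (j' <= k')%N ->
      span_mod v S (brF (brF (e i') (e j')) (e k')).
    move=> ji jk; have H : hall_triple (j', (i', k')) by rewrite /hall_triple /= ji.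
    by have := gen_span_mod v subS (Sub (j', (i', k')) H); rewrite {2}/v SubK.
  (* If k' < j', Jacobi gives [[i',j'],k'] = [[i',k'],j'] - [[j',k'],i'], and both terms are Hall
     commutators. *)
  have Qdesc (i' j' k' : 'I_n) : (j' < i')%N ->
      span_mod v S (brF (brF (e i') (e j')) (e k')).
    move=> ji; have [jk | kj] := leqP j' k'; first exact: Qhall.
    rewrite br_br_l // (brC lieF _ (brF _ _)); apply: subspaceB => //.
      by apply: Qhall; [exact: ltn_trans kj ji | exact: ltnW].
    by apply: Qhall => //; apply/ltnW/(ltn_trans kj).
  case: (ltngtP j i) => [ji | ij | /val_inj ->]; first exact: Qdesc.
    by rewrite (brC lieF (e i)) brNl //; apply: subspaceN => //; apply: Qdesc.
  by rewrite brxx // br0l //; apply: subspace0.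
Qed.

Lemma nilmult2_heisenberg1 : m = 1%N -> nilmult2_is_A brF R 5.
Proof.
move=> m1; have [z [z0 br_z centre_z z_centre]] := heisenberg_centre_vector.
have dimL : \dim (fullv : {vspace L}) = 3 by case: heis; rewrite m1.
have [u [h [h0 [[lh lh0] hE hu [hz h0u h0z]]]]] := coordinates_with_vector z0 dimL.
pose i1 : 'I_2 := lift ord0 ord0.
have I2 (i : 'I_2) : i = ord0 \/ i = i1.
  by case: i => [[|[|//]] ?]; [left | right]; apply: val_inj.
have [t ut] := br_z (u ord0) (u i1).
have z_centre' x : brL x z = 0 by rewrite brC // z_centre oppr0.
have t0 : t != 0.
  (* If t were 0, the first basis vector would commute with the basis, hence be a multiple of z,
     against its own coordinate being 1. *)
  apply/eqP => tz; have [x | k uk] := centre_z (u ord0).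
    rewrite [x]hE !big_ord_recl big_ord0 addr0 !(brDr lieL, brZr lieL) (brxx lieL).
    rewrite -/i1 ut tz.
    by rewrite z_centre' scale0r !scaler0 !addr0.
  have /eqP := hu ord0 ord0.
  by rewrite uk (linZ (lh ord0)) hz scaler0 eqxx eq_sym oner_eq0.
have [e eE] := fin_all_exists (fun i => pi_surj (u i)).
pose c := brF (e ord0) (e i1).
have cE : pi c = t *: z by rewrite /c pi_br !eE ut.
(* The third basis vector is now [pi c] = t z instead of z, so its coordinate is divided by t. *)
pose h2 x : K := t^-1 * h0 x.
have xE x : x = h ord0 x *: u ord0 + h i1 x *: u i1 + h2 x *: pi c.
  rewrite {1}[x]hE !big_ord_recl big_ord0 addr0 cE scalerA /h2.
  by rewrite mulrAC mulVf // mul1r.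
pose v (i : 'I_5) := [:: brF c (e ord0); brF c (e i1); brF (brF c (e ord0)) (e ord0);
  brF (brF c (e ord0)) (e i1); brF (brF c (e i1)) (e i1)]`_i.
have subS : subspace S by apply: subspace_span.
rewrite -(card_ord 5); apply: (nilmult2_fin (v := v)) => //.
- exact: triple_bracket_ker.
- exact: subspaceR.
- case; do 5?[case=> [? |]] => //; rewrite /v /=;
    [exists (e ord0), (e i1), (e ord0) | exists (e ord0), (e i1), (e i1)
    | exists c, (e ord0), (e ord0) | exists c, (e ord0), (e i1)
    | exists c, (e i1), (e i1)]; by [].
(* The list has three entries, so the default 0 of [nth] fills weights 3 and 4. *)
- have [[g [[lg g_br] g_iota]] _] := freeF.2 _ _ (nil4_lie K)
    (fun x => \row_i [:: h ord0 (pi (iota x)); h i1 (pi (iota x)); h2 (pi (iota x))]`_i).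
  (* [q] forgets weights 3 and 4, which leaves H(1). By freeness q composed with g is [pi], so g
     sends R to weight at least 3. *)
  pose q (w : 'rV[K]_8) := w 0 (inord 0) *: u ord0 + w 0 (inord 1) *: u i1 +
    w 0 (inord 2) *: pi c.
  have qg x : q (g x) = pi x.
    have [_ /(_ (fun x => q (g x)) pi)] := freeF.2 _ _ lieL (fun x => pi (iota x)).
    apply=> //.
    + split=> [a y y' | y y'].
        rewrite lg /q !mxE !scalerDr !scalerA !scalerDl.
        by rewrite [RHS]addrACA [X in _ = X + _]addrACA.
      rewrite g_br /q !nil4_brE //= !scale0r !add0r cE.
      rewrite !(brDl lieL, brDr lieL, brZl lieL, brZr lieL) !(brxx lieL).
      rewrite !z_centre !z_centre'.
      rewrite (brC lieL (u i1)) ut !(scaler0, addr0, add0r, scalerN).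
      rewrite !scalerA -scaleNr -scalerDl.
      by congr (_ *: _); ring.
    + by move=> y; rewrite g_iota /q !mxE !inordK //= -xE.
  have h0c : h ord0 (pi c) = 0 by rewrite cE (linZ (lh _)) hz scaler0.
  have h1c : h i1 (pi c) = 0 by rewrite cE (linZ (lh _)) hz scaler0.
  have h2c : h2 (pi c) = 1 by rewrite cE /h2 (linZ lh0) h0z /GRing.scale /= mulr1 mulVf.
  have h2u i : h2 (u i) = 0 by rewrite /h2 h0u mulr0.
  have lh2 : linear (h2 : L -> K^o).
    by move=> a x y; rewrite /h2 lh0 mulrDr mulrCA.
  have g0 x : g x 0 (inord 0) = h ord0 (pi x).
    rewrite -qg !(linD (lh _)) !(linZ (lh _)) !hu h0c /=.
    by rewrite !scaler0 !addr0 /GRing.scale /= mulr1.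
  have g1 x : g x 0 (inord 1) = h i1 (pi x).
    rewrite -qg !(linD (lh _)) !(linZ (lh _)) !hu h1c /=.
    by rewrite !scaler0 addr0 add0r /GRing.scale /= mulr1.
  have g2 x : g x 0 (inord 2) = h2 (pi x).
    rewrite -qg !(linD lh2) !(linZ lh2) !h2u h2c /=.
    by rewrite !scaler0 !add0r /GRing.scale /= mulr1.
  pose phi (i : 'I_5) (x : F) : K^o := g x 0 (inord (3 + i)).
  have lphi i : linear (phi i) by move=> a x y; rewrite /phi lg !mxE.
  have phi_v i j : phi i (v j) = (i == j)%:R.
    have ge0 : [/\ g (e ord0) 0 (inord 0) = 1, g (e ord0) 0 (inord 1) = 0
                 & g (e ord0) 0 (inord 2) = 0].
      by rewrite g0 g1 g2 eE !hu h2u.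
    have ge1 : [/\ g (e i1) 0 (inord 0) = 0, g (e i1) 0 (inord 1) = 1
                 & g (e i1) 0 (inord 2) = 0].
      by rewrite g0 g1 g2 eE !hu h2u.
    move: ge0 ge1 => [e00 e01 e02] [e10 e11 e12].
    have [E3 E4 E5 E6 E7] := nil4_generators e00 e01 e02 e10 e11 e12.
    have gv : g (v j) = delta_mx 0 (inord (3 + j)).
      rewrite /v /c; move: j; case; do 5?[case=> [? |]] => //;
        by rewrite /= !g_br ?E3 ?E4 ?E5 ?E6 ?E7.
    have i8 : (3 + i < 8)%N by rewrite -[8%N]/(3 + 5)%N ltn_add2l.
    have j8 : (3 + j < 8)%N by rewrite -[8%N]/(3 + 5)%N ltn_add2l.
    by rewrite /phi gv mxE eqxx -!val_eqE /= !inordK // eqn_add2l.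
  apply: (indep_of_dual (phi := phi)) => //.
  + move=> i; apply: RFF_min => //; first exact: subspace_ker.
    move=> r a b Rr; have [r0 r1 r2] : [/\ g r 0 (inord 0) = 0,
      g r 0 (inord 1) = 0 & g r 0 (inord 2) = 0].
      by rewrite g0 g1 g2 Rr !(lin0 (lh _)) (lin0 lh2).
    by rewrite /phi !g_br nil4_br_br0 // mxE.
  + by move=> i; rewrite phi_v eqxx oner_eq0.
  + by move=> i j /negbTE ij; rewrite phi_v ij.
- have subQ := subspace_span_mod v subS.
  have Qv (i : nat) : (i < 5)%N -> span_mod v S [:: brF c (e ord0); brF c (e i1);
      brF (brF c (e ord0)) (e ord0); brF (brF c (e ord0)) (e i1);
      brF (brF c (e i1)) (e i1)]`_i.
    by move=> i5; exact: (gen_span_mod v subS (Ordinal i5)).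
  have SQ x : S x -> span_mod v S x by apply: sub_span_mod.
  have Qc (i : 'I_2) d : (exists j, d = e j) \/ d = c ->
      span_mod v S (brF (brF c (e i)) d).
    case=> [[j ->] | ->]; last first.
      (* Here [c,e_i] is a triple bracket, hence in R, and c is itself the bracket [e0,e1]. *)
      by apply: SQ; apply: RFF_br => //; apply: RF_l; apply: triple_bracket_ker.
    case: (I2 i) (I2 j) => -> [] ->; [exact: (Qv 2%N) | exact: (Qv 3%N) | | exact: (Qv 4%N)].
    (* [[c,e1],e0] and [[c,e0],e1] differ by [c,[e1,e0]] = -[c,c] = 0. *)
    rewrite br_br_l // (brC lieF (e i1)) brNr // brxx // oppr0 addr0.
    exact: (Qv 3%N).
  apply: (@triple_brackets_ind _ _ _ R lieF _ e c _ (span_mod v S)) => //.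
    apply: (generators_mod_ker (h := h) (h0 := h2)) => x.
    by rewrite {1}[x]xE !big_ord_recl big_ord0 addr0 !eE.
  move=> a b d [[i ->] | ->] [[j ->] | ->] Gd.
  + have Qcd : span_mod v S (brF c d).
      case: Gd => [[k ->] | ->]; last by rewrite brxx //; apply: subspace0.
      by case: (I2 k) => ->; [exact: (Qv 0%N) | exact: (Qv 1%N)].
    case: (I2 i) (I2 j) => -> [] ->; rewrite ?brxx ?br0l //; try exact: subspace0.
    by rewrite (brC lieF (e i1)) brNl //; apply: subspaceN.
  + by rewrite (brC lieF (e i)) brNl //; apply: subspaceN => //; apply: Qc.
  + exact: Qc.
  + by rewrite brxx // br0l //; apply: subspace0.
Qed.

End HeisenbergMultiplier.

Unset Implicit Arguments.
Set Strict Implicit.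

Theorem theorem2p11 (K : fieldType) (m : nat) (L : vectType K) (brL : L -> L -> L)
  (F : lmodType K) (brF : F -> F -> F) (X : Type) (iota : X -> F) (pi : F -> L) :
  (0 < m)%N ->
  is_heisenberg m brL ->
  is_free_lie brF iota ->
  is_lie_hom brF brL pi ->
  (forall y : L, exists x : F, pi x = y) ->
  (m = 1%N -> nilmult2_is_A brF (fun x => pi x = 0) 5) /\
  ((2 <= m)%N -> nilmult2_is_A brF (fun x => pi x = 0) ((8 * m ^ 3 - 2 * m) %/ 3)).
Proof.
move=> _ heis freeF pi_hom pi_surj; split.
  exact: (nilmult2_heisenberg1 heis freeF pi_hom pi_surj).
exact: (nilmult2_heisenberg_ge2 heis freeF pi_hom pi_surj).
Qed.
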